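(* Let $(\mathcal A,\sigma)$ be an involutive ring and let $X,Y\in \mathrm{Sp}_2(\mathcal A,\sigma)^r$. Then $$\mathrm{tr}\big(X\,\sigma(\sigma(Y)\sigma(X^{-1}))\,Y^{-1}\big)=\mathrm{tr}(X)\sigma(\mathrm{tr}(X))+\mathrm{tr}(Y)\sigma(\mathrm{tr}(Y))+\mathrm{tr}\big(X\,\sigma(\sigma(Y)X)\,\sigma(Y)\big)-\mathrm{tr}(X)\,\mathrm{tr}(\sigma(X)Y)\,\sigma(\mathrm{tr}(Y)).$$
   Context: An involutive ring $(\mathcal A,\sigma)$ is a unital (possibly noncommutative) ring $\mathcal A$ with an anti-involution $\sigma$, i.e. $\sigma$ is additive, $\sigma(ab)=\sigma(b)\sigma(a)$ and $\sigma(\sigma(a))=a$. For a $2\times2$ matrix $M=\begin{bmatrix}A&B\\C&D\end{bmatrix}$ over $\mathcal A$: $\sigma(M)$ denotes the entrywise application of $\sigma$ (no transposition; in general $\sigma(MN)\neq\sigma(N)\sigma(M)$), $M^T$ is the plain transpose, and $\mathrm{tr}(M)=A+D\in\mathcal A$. With $\Omega_1=\begin{bmatrix}0&1\\-1&0\end{bmatrix}$, the right symplectic monoid is $\mathrm{Sp}_2(\mathcal A,\sigma)^r=\{M\in\mathrm{Mat}_2(\mathcal A): M\,\Omega_1\,\sigma(M)^T=\Omega_1\}$. For $M\in\mathrm{Sp}_2(\mathcal A,\sigma)^r$, $M^{-1}$ denotes the right inverse of $M$ given by the adjoint matrix $\mathrm{Adj}(M)=\begin{bmatrix}\sigma(D)&-\sigma(B)\\-\sigma(C)&\sigma(A)\end{bmatrix}$,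 which satisfies $M\,\mathrm{Adj}(M)=\mathrm{Id}$. *)

(* Defs.v *)
From mathcomp Require Import all_boot all_order all_algebra.

Set Implicit Arguments.
Unset Strict Implicit.
Unset Printing Implicit Defensive.

Import GRing.Theory.
Local Open Scope ring_scope.

(* [sigma 1 = 1] is not required: it follows from the three conditions. *)
Definition anti_involution (A : pzRingType) (sigma : A -> A) : Prop :=
  [/\ {morph sigma : a b / a + b},
      forall a b : A, sigma (a * b) = sigma b * sigma a
    & involutive sigma].

Definition mx2 (A : pzRingType) (a b c d : A) : 'M[A]_2 :=
  \matrix_(i, j) if i == 0 then (if j == 0 then a else b)
                 else (if j == 0 then c else d).

Definition Omega1 (A : pzRingType) : 'M[A]_2 := mx2 0 1 (- 1) 0.

Definition Sp2r (A : pzRingType) (sigma : A -> A) (M : 'M[A]_2) : Prop :=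
  M *m Omega1 A *m (map_mx sigma M)^T = Omega1 A.

(* Not the library's [\adj M], which does not involve [sigma]. *)
Definition Adj (A : pzRingType) (sigma : A -> A) (M : 'M[A]_2) : 'M[A]_2 :=
  mx2 (sigma (M 1 1)) (- sigma (M 0 1)) (- sigma (M 1 0)) (sigma (M 0 0)).

(* Only a right inverse in general; the left-hand identity may fail. *)
Lemma mulmx_Adj (A : pzRingType) (sigma : A -> A) (M : 'M[A]_2) :
  Sp2r sigma M -> M *m Adj sigma M = 1%:M.
Proof.
move=> hM.
have entry i j : M i 0 * sigma (M j 1) - M i 1 * sigma (M j 0) = Omega1 A i j.
  rewrite -hM !mxE !big_ord_recl big_ord0 !mxE !big_ord_recl !big_ord0 !mxE /=.
  have -> : lift ord0 ord0 = 1 :> 'I_2 by apply: val_inj.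
  by rewrite !mulr0 !add0r !addr0 mulr1 mulrN1 mulNr addrC.
apply/matrixP=> i j; rewrite !mxE !big_ord_recl big_ord0 addr0 !mxE /=.
have -> : lift ord0 ord0 = 1 :> 'I_2 by apply: val_inj.
have [-> | ->] : j = 0 \/ j = 1.
- by case: j => [[|[|//]] hj]; [left | right]; apply: val_inj.
- have := entry i 1; rewrite mulrN => ->; rewrite mxE.
  by case: i => [[|[|//]] hi].
- rewrite /= mulrN addrC; have := entry i 0.
  move/(congr1 -%R); rewrite opprB => ->; rewrite mxE.
  by case: i => [[|[|//]] hi]; rewrite /= ?oppr0 ?opprK.
Qed.

(* Main.v *)
Require Import Defs.
From mathcomp Require Import all_boot all_order all_algebra.

Set Implicit Arguments.
Unset Strict Implicit.
Unset Printing Implicit Defensive.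

Import GRing.Theory.
Local Open Scope ring_scope.

(** The adjoint is linear in [sigma M]: writing [s = sigma (\tr X)] and
    [t = sigma (\tr Y)], one has [Adj X = s - sigma X] and [Adj Y = t - sigma Y]
    ([Adj_trace]).  Since [sigma] reverses products, the inner factor
    [sigma (sigma Y * sigma Z)] is the product of [Y] and [Z] computed with the
    multiplication of the opposite ring, that is [(Z^T * Y^T)^T]
    ([map_mul_anti]), which is linear in [Z].  Hence, with
    [V = sigma (sigma Y * X)], the left-hand side expands as
      [tr (X * (s Y) * Adj Y) - tr (X * V) * t + tr (X * V * sigma Y)].
    The first term is [tr X * s], because [Y * Adj Y = 1].  For the second one,
    [tr (X * V) = tr (X^T * (sigma X)^T * Y^T)], and the symplectic relation
    for [X] is equivalent to a Cayley-Hamilton identity for the transpose,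
    [X^T * (sigma X)^T = tr X * (sigma X)^T - 1] ([trmx_Cayley_Hamilton]), which
    yields [tr (X * V) = tr X * tr (sigma X * Y) - tr Y].  The cyclicity
    of the trace fails over a noncommutative ring; its role is played by
    [tr (M * N) = tr (M^T * N^T)] ([mxtrace_mul_trmx]). *)

(** The entries of both products are multiplied in the same order, so this
    substitute for the cyclicity of the trace survives noncommutativity. *)
Lemma mxtrace_mul_trmx (A : pzRingType) m n (M : 'M[A]_(m, n))
    (N : 'M[A]_(n, m)) :
  \tr (M *m N) = \tr (M^T *m N^T).
Proof.
rewrite /mxtrace; under eq_bigr do rewrite mxE.
rewrite exchange_big; apply: eq_bigr => i _; rewrite mxE.
by apply: eq_bigr => j _; rewrite !mxE.
Qed.

Lemma mxtrace_mul_scalar (A : pzRingType) n (M : 'M[A]_n) (a : A) :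
  \tr (M *m a%:M) = \tr M * a.
Proof.
rewrite /mxtrace mulr_suml; apply: eq_bigr => i _.
rewrite mxE (bigD1 i) //= big1 => [|j /negPf ji].
  by rewrite mxE eqxx mulr1n addr0.
by rewrite mxE ji mulr0n mulr0.
Qed.

Lemma ord2P (i : 'I_2) : i = 0 \/ i = 1.
Proof. by case: i => [[|[|//]] hi]; [left | right]; apply: val_inj. Qed.

Lemma mxtrace2 (A : pzRingType) (M : 'M[A]_2) : \tr M = M 0 0 + M 1 1.
Proof.
rewrite /mxtrace !big_ord_recl big_ord0 addr0.
by congr (_ + M _ _); apply: val_inj.
Qed.

(** As [Omega1] and [- Omega1] are inverse to each other, the left-hand side is
    minus a conjugate of [M], which for size two is the classical adjugate of
    [M^T]; no entries of [M] get multiplied, so [A] may be noncommutative. *)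
Lemma conj_Omega1 (A : pzRingType) (M : 'M[A]_2) :
  Omega1 A *m M *m Omega1 A = M^T - (\tr M)%:M.
Proof.
rewrite mxtrace2; apply/matrixP=> i j.
rewrite !mxE !big_ord_recl big_ord0 !mxE !big_ord_recl !big_ord0 !mxE /=.
have -> : lift ord0 ord0 = 1 :> 'I_2 by apply: val_inj.
case: (ord2P i) => ->; case: (ord2P j) => -> /=;
  rewrite ?(mul0r, mulr0, mul1r, mulr1, mulN1r, mulrN1, add0r, addr0);
  rewrite ?(mulr1n, mulr0n, subr0, opprK) //.
- by rewrite opprD addNKr.
- by rewrite opprD addrC addrNK.
Qed.

Lemma Omega1_sqr (A : pzRingType) : Omega1 A *m Omega1 A = - 1%:M.
Proof.
apply/matrixP=> i j; rewrite !mxE !big_ord_recl big_ord0 !mxE /=.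
by case: (ord2P i) => ->; case: (ord2P j) => -> /=;
  rewrite ?(mul0r, mulr0, mul1r, mulr1, add0r, addr0, mulr0n, oppr0).
Qed.

Section AntiInvolution.

Variables (A : pzRingType) (sigma : A -> A).
Hypothesis hsigma : anti_involution sigma.

Lemma anti_involution0 : sigma 0 = 0.
Proof.
have [sigmaD _ _] := hsigma.
by apply: (addrI (sigma 0)); rewrite -sigmaD !addr0.
Qed.

Lemma anti_involution_sum (I : Type) (r : seq I) (P : pred I) (F : I -> A) :
  sigma (\sum_(i <- r | P i) F i) = \sum_(i <- r | P i) sigma (F i).
Proof.
have [sigmaD _ _] := hsigma.
exact: (big_morph _ sigmaD anti_involution0).
Qed.

Lemma map_mx_anti_involutionK m n (M : 'M[A]_(m, n)) :
  map_mx sigma (map_mx sigma M) = M.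
Proof.
have [_ _ sigmaK] := hsigma.
by apply/matrixP=> i j; rewrite !mxE sigmaK.
Qed.

(** Applying [sigma] entrywise reverses the product of the entries while
    leaving the indices in place; transposing both factors puts them back in
    an order for which this is again a matrix product over [A]. *)
Lemma map_mul_anti m n p (Y : 'M[A]_(m, n)) (Z : 'M[A]_(n, p)) :
  map_mx sigma (map_mx sigma Y *m map_mx sigma Z) = (Z^T *m Y^T)^T.
Proof.
have [_ sigmaM sigmaK] := hsigma.
apply/matrixP=> i j; rewrite !mxE anti_involution_sum.
by apply: eq_bigr => k _; rewrite !mxE sigmaM !sigmaK.
Qed.

Lemma Adj_trace (M : 'M[A]_2) :
  Adj sigma M = (sigma (\tr M))%:M - map_mx sigma M.
Proof.
have [sigmaD _ _] := hsigma.
rewrite mxtrace2 sigmaD; apply/matrixP=> i j; rewrite !mxE.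
by case: (ord2P i) => ->; case: (ord2P j) => -> /=;
  rewrite ?mulr1n ?mulr0n ?sub0r // ?addrK // addrC addKr.
Qed.

(** Multiplying the symplectic relation on the left by [Omega1] turns it into
    [(X^T - tr X) * (sigma X)^T = - 1]. *)
Lemma trmx_Cayley_Hamilton (X : 'M[A]_2) : Sp2r sigma X ->
  X^T *m (map_mx sigma X)^T = \tr X *: (map_mx sigma X)^T - 1%:M.
Proof.
move=> hX; have := Omega1_sqr A; rewrite -{2}hX !mulmxA conj_Omega1.
by rewrite mulmxBl mul_scalar_mx => /(canRL (subrK _)) ->; rewrite addrC.
Qed.

Lemma mxtrace_mul_anti (X Y : 'M[A]_2) : Sp2r sigma X ->
  \tr (X *m map_mx sigma (map_mx sigma Y *m X))
    = \tr X * \tr (map_mx sigma X *m Y) - \tr Y.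
Proof.
move=> hX; rewrite -{2}[X]map_mx_anti_involutionK map_mul_anti.
rewrite mxtrace_mul_trmx trmxK mulmxA (trmx_Cayley_Hamilton hX).
rewrite mulmxBl mul1mx -scalemxAl linearB /= mxtraceZ mxtrace_tr.
by rewrite -mxtrace_mul_trmx.
Qed.

End AntiInvolution.

Theorem corollary4p7 (A : pzRingType) (sigma : A -> A)
  (hsigma : anti_involution sigma) (X Y : 'M[A]_2)
  (hX : Sp2r sigma X) (hY : Sp2r sigma Y) :
  \tr (X *m map_mx sigma (map_mx sigma Y *m map_mx sigma (Adj sigma X))
         *m Adj sigma Y)
  = \tr X * sigma (\tr X) + \tr Y * sigma (\tr Y)
    + \tr (X *m map_mx sigma (map_mx sigma Y *m X) *m map_mx sigma Y)
    - \tr X * \tr (map_mx sigma X *m Y) * sigma (\tr Y).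
Proof.
have trXV := mxtrace_mul_anti hsigma Y hX.
set V := map_mx sigma (map_mx sigma Y *m X) in trXV *.
have defV : V = ((map_mx sigma X)^T *m Y^T)^T.
  by rewrite /V -{1}[X](map_mx_anti_involutionK hsigma) map_mul_anti.
rewrite map_mul_anti // {1}(Adj_trace hsigma X).
rewrite linearB /= tr_scalar_mx mulmxBl mul_scalar_mx linearB /= linearZ /=.
rewrite trmxK -defV mulmxBr mulmxBl linearB /=.
have -> : \tr (X *m (sigma (\tr X) *: Y) *m Adj sigma Y)
    = \tr X * sigma (\tr X).
  rewrite -mulmxA -scalemxAl (mulmx_Adj hY) scalemx1.
  exact: mxtrace_mul_scalar.
rewrite (Adj_trace hsigma Y) mulmxBr linearB /= mxtrace_mul_scalar trXV.
by rewrite mulrBl !opprB -!addrA; congr (_ + _); rewrite [RHS]addrCA addrCA.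
Qed.
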